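(* Let $E$ be a connected graded Frobenius algebra whose Nakayama automorphism $\mu_E$ restricts to a scalar multiplication on $E_1$. Let $K$ be a Hopf algebra with antipode $S$ such that $E$ is a left $K$-comodule algebra with grading-preserving coaction, the coaction on $E_1$ is inner-faithful, and the homological codeterminant is trivial. Then $S^2=\mathrm{Id}_K$. If in addition $K$ is finite dimensional and $\mathrm{char}\,k$ does not divide $\dim K$, then $H=K^\circ$ is semisimple.
   Context: A connected graded algebra $E$ is Frobenius if it is finite dimensional with a nondegenerate associative graded bilinear form $\langle-,-\rangle$; its Nakayama automorphism $\mu_E$ satisfies $\langle a,b\rangle=\langle b,\mu_E(a)\rangle$. The top nonzero degree of $E$ is one-dimensional, spanned by $\mathfrak e$; the homological codeterminant is the grouplike ${\sf D}\in K$ with $\rho(\mathfrak e)={\sf D}\otimes\mathfrak e$, and it is trivial if ${\sf D}=1_K$. Inner-faithful on $E_1$: $\rho(E_1)\not\subseteq K'\otimes E_1$ for every proper Hopf subalgebra $K'\subsetneq K$. $K^\circ$ is the Hopf dual. *)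

(* Defs.v *)
From HB Require Import structures.
From mathcomp Require Import all_boot all_order all_algebra all_field.
Set Implicit Arguments. Unset Strict Implicit. Unset Printing Implicit Defensive.
Import Order.TTheory GRing.Theory Num.Theory.
Local Open Scope ring_scope.

(* Tensor products over a field k, encoded by finite sums of pure      *)
(* tensors (lists of pairs / triples).  Two lists represent the same    *)
(* element of U (x) V iff they agree under every bilinear map into      *)
(* every k-module (universal property of the tensor product).           *)
Section Tensor.
Variable k : fieldType.

Definition bilin (U V W : lmodType k) (f : U -> V -> W) : Prop :=
  (forall (a : k) x x' y, f (a *: x + x') y = a *: f x y + f x' y) /\
  (forall (a : k) x y y', f x (a *: y + y') = a *: f x y + f x y').

Definition trilin (U V X W : lmodType k) (f : U -> V -> X -> W) : Prop :=
  (forall (a : k) x x' y z, f (a *: x + x') y z = a *: f x y z + f x' y z) /\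
  (forall (a : k) x y y' z, f x (a *: y + y') z = a *: f x y z + f x y' z) /\
  (forall (a : k) x y z z', f x y (a *: z + z') = a *: f x y z + f x y z').

Definition teq (U V : lmodType k) (s t : seq (U * V)) : Prop :=
  forall (W : lmodType k) (f : U -> V -> W), bilin f ->
    \sum_(p <- s) f p.1 p.2 = \sum_(p <- t) f p.1 p.2.

Definition teq3 (U V X : lmodType k) (s t : seq (U * V * X)) : Prop :=
  forall (W : lmodType k) (f : U -> V -> X -> W), trilin f ->
    \sum_(p <- s) f p.1.1 p.1.2 p.2 = \sum_(p <- t) f p.1.1 p.1.2 p.2.

Definition is_hopf (K : algType k) (Delta : K -> seq (K * K)) (eps : K -> k)
    (S : K -> K) : Prop :=
  [/\
      forall (a : k) x y,
        teq (Delta (a *: x + y)) ([seq (a *: p.1, p.2) | p <- Delta x] ++ Delta y),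
      forall x, teq3 [seq (q.1, q.2, p.2) | p <- Delta x, q <- Delta p.1]
                     [seq (p.1, q.1, q.2) | p <- Delta x, q <- Delta p.2],
      (forall (a : k) x y, eps (a *: x + y) = a * eps x + eps y) /\
      (forall x, \sum_(p <- Delta x) eps p.1 *: p.2 = x) /\
      (forall x, \sum_(p <- Delta x) eps p.2 *: p.1 = x),
      (forall x y, teq (Delta (x * y))
                      [seq (p.1 * q.1, p.2 * q.2) | p <- Delta x, q <- Delta y]) /\
      teq (Delta 1) [:: (1, 1)] /\
      (forall x y, eps (x * y) = eps x * eps y) /\ eps 1 = 1 &
      (forall (a : k) x y, S (a *: x + y) = a *: S x + S y) /\
      (forall x, \sum_(p <- Delta x) S p.1 * p.2 = eps x *: 1) /\
      (forall x, \sum_(p <- Delta x) p.1 * S p.2 = eps x *: 1)].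

Definition is_hopf_subalg (K : algType k) (Delta : K -> seq (K * K)) (S : K -> K)
    (K' : K -> Prop) : Prop :=
  [/\ K' 1,
      forall (a : k) x y, K' x -> K' y -> K' (a *: x + y),
      forall x y, K' x -> K' y -> K' (x * y),
      forall x, K' x -> K' (S x) &
      forall x, K' x -> exists s, teq (Delta x) s /\
                     forall p, p \in s -> K' p.1 /\ K' p.2].

Definition is_comod_alg (K : algType k) (E : falgType k)
    (Delta : K -> seq (K * K)) (eps : K -> k) (rho : E -> seq (K * E)) : Prop :=
  [/\ forall (a : k) x y,
        teq (rho (a *: x + y)) ([seq (a *: p.1, p.2) | p <- rho x] ++ rho y),
      forall x, teq3 [seq (q.1, q.2, p.2) | p <- rho x, q <- Delta p.1]
                     [seq (p.1, q.1, q.2) | p <- rho x, q <- rho p.2],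
      forall x, \sum_(p <- rho x) eps p.1 *: p.2 = x,
      forall x y, teq (rho (x * y))
                      [seq (p.1 * q.1, p.2 * q.2) | p <- rho x, q <- rho y] &
      teq (rho 1) [:: (1, 1)]].

Definition is_conn_graded (E : falgType k) (Eg : nat -> {vspace E}) : Prop :=
  [/\ forall n, directv (\sum_(i < n) Eg i),
      exists n, (\sum_(i < n) Eg i)%VS = fullv,
      forall i j x y, x \in Eg i -> y \in Eg j -> x * y \in Eg (i + j) &
      Eg 0%N = <[1 : E]>%VS].

Definition is_graded_frobenius_form (E : falgType k) (Eg : nat -> {vspace E})
    (B : E -> E -> k) : Prop :=
  [/\
      (forall (a : k) x x' y, B (a *: x + x') y = a * B x y + B x' y) /\
      (forall (a : k) x y y', B x (a *: y + y') = a * B x y + B x y'),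
      forall x y z, B (x * y) z = B x (y * z),
      (forall x, (forall y, B x y = 0) -> x = 0) /\
      (forall y, (forall x, B x y = 0) -> y = 0) &
      exists d, forall i j x y, x \in Eg i -> y \in Eg j -> (i + j != d)%N ->
        B x y = 0].

Definition is_nakayama (E : falgType k) (B : E -> E -> k) (mu : E -> E) : Prop :=
  forall a b, B a b = B b (mu a).

(* Finite dimensionality and the dual algebra K^* (= K° when K is      *)
(* finite dimensional), with convolution product.                       *)
Definition fin_dim_with (K : lmodType k) (n : nat) : Prop :=
  exists b : 'I_n -> K,
    (forall c : 'I_n -> k, \sum_(i < n) c i *: b i = 0 -> forall i, c i = 0) /\
    (forall x, exists c : 'I_n -> k, x = \sum_(i < n) c i *: b i).

Definition lin_functional (K : lmodType k) (f : K -> k) : Prop :=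
  forall (a : k) x y, f (a *: x + y) = a * f x + f y.

Definition conv (K : lmodType k) (Delta : K -> seq (K * K)) (f g : K -> k) : K -> k :=
  fun x => \sum_(p <- Delta x) f p.1 * g p.2.

Definition dual_left_ideal (K : lmodType k) (Delta : K -> seq (K * K))
    (I : (K -> k) -> Prop) : Prop :=
  [/\ forall f, I f -> lin_functional f,
      I (fun _ => 0),
      forall f g, I f -> I g -> I (fun x => f x + g x),
      forall (a : k) f, I f -> I (fun x => a * f x) &
      forall h f, lin_functional h -> I f -> I (conv Delta h f)].

Definition dual_semisimple (K : lmodType k) (Delta : K -> seq (K * K)) : Prop :=
  forall I, dual_left_ideal Delta I ->
    exists J, [/\ dual_left_ideal Delta J,
      (forall f, I f -> J f -> forall x, f x = 0) &
      (forall f, lin_functional f ->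
         exists g h, [/\ I g, J h & forall x, f x = g x + h x])].

End Tensor.

(* Main.v *)
(** Choose dual bases e_i of E_1 and f_j of E_(d-1) for the Frobenius form, d being the
    top degree, and let Y, G be the matrices of the coaction on them.  Triviality of the
    codeterminant makes the form coinvariant, which gives Y G^T = 1; since the Nakayama
    automorphism is scalar on E_1, also G Y^T = 1.  As S inverts the matrix of a comodule,
    S(Y) = G^T and S(G) = Y^T.  Hence S^2 fixes the entries of Y and G, and these generate
    a Hopf subalgebra, which is K by inner faithfulness.

    If S^2 = id and K is finite dimensional, the trace of left multiplication is an
    integral chi in K^*, and chi(1) = dim K is invertible; averaging a linear projection
    onto a left ideal of K^* against chi proves Maschke's theorem for K^*. *)
Require Import Defs.
From HB Require Import structures.
From mathcomp Require Import all_boot all_order all_algebra all_field.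
From Stdlib Require Import Classical FunctionalExtensionality.
Import Order.TTheory GRing.Theory Num.Theory.
Set Implicit Arguments. Unset Strict Implicit. Unset Printing Implicit Defensive.
Local Open Scope ring_scope.

(** * Linear and multilinear maps, and sums over pure tensors *)

Section Linearity.
Variable k : fieldType.

Definition lin (U W : lmodType k) (f : U -> W) : Prop :=
  forall (a : k) x y, f (a *: x + y) = a *: f x + f y.

(** For bilinear [f] this is the induced linear map evaluated at the tensor represented by [s], so
    it depends only on the class of [s] under [teq]. Sweedler sums take the form
    [tsum f (Delta x)]. *)
Definition tsum (U V W : lmodType k) (f : U -> V -> W) (s : seq (U * V)) : W :=
  \sum_(p <- s) f p.1 p.2.

Section Maps.
Variables U W : lmodType k.

Lemma lin0 (f : U -> W) : lin f -> f 0 = 0.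
Proof. by move=> lf; have := lf (-1) 0 0; rewrite scaler0 addr0 scaleN1r addNr. Qed.

Lemma linD (f : U -> W) : lin f -> {morph f : x y / x + y}.
Proof. by move=> lf x y; rewrite -{1}[x]scale1r lf scale1r. Qed.

Lemma linZ (f : U -> W) : lin f -> forall a, {morph f : x / a *: x}.
Proof. by move=> lf a x; rewrite -[a *: x]addr0 lf lin0 // addr0. Qed.

Lemma lin_sum (f : U -> W) : lin f ->
  forall I (r : seq I) (P : pred I) (F : I -> U),
  f (\sum_(i <- r | P i) F i) = \sum_(i <- r | P i) f (F i).
Proof. by move=> lf I r P F; apply: big_morph; [apply: linD | apply: lin0]. Qed.

End Maps.

Section MultilinearMaps.
Variables U V X W : lmodType k.

Lemma lin_tsum (g : X -> W) (f : U -> V -> X) s : lin g ->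
  g (tsum f s) = tsum (fun a b => g (f a b)) s.
Proof. by move=> lg; rewrite /tsum (lin_sum lg). Qed.

Lemma eq_tsum (f g : U -> V -> W) s :
  (forall a b, f a b = g a b) -> tsum f s = tsum g s.
Proof. by move=> fg; apply: eq_bigr => p _; apply: fg. Qed.

Lemma bilinP (f : U -> V -> W) :
  (forall y, lin (f^~ y)) -> (forall x, lin (f x)) -> bilin f.
Proof. by move=> l1 l2; split=> a x *; [apply: l1 | apply: l2]. Qed.

Lemma trilinP (f : U -> V -> X -> W) :
  (forall y z, lin (fun x => f x y z)) -> (forall x z, lin (fun y => f x y z)) ->
  (forall x y, lin (f x y)) -> trilin f.
Proof.
by move=> l1 l2 l3; split; [|split] => a x *; [apply: l1 | apply: l2 | apply: l3].
Qed.
End MultilinearMaps.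

Lemma tsum_exchange (U V U' V' W : lmodType k) (f : U -> V -> U' -> V' -> W) s t :
  tsum (fun a b => tsum (f a b) t) s
  = tsum (fun c d => tsum (fun a b => f a b c d) s) t.
Proof. exact: exchange_big. Qed.

Section Closure.
Variables T U V X W : lmodType k.

Lemma lin_id : lin (fun x : T => x). Proof. by []. Qed.

Lemma lin_comp (f : U -> W) (g : T -> U) : lin f -> lin g -> lin (fun x => f (g x)).
Proof. by move=> lf lg a x y; rewrite lg lf. Qed.

Lemma functional_comp (f : U -> k) (g : T -> U) :
  lin_functional f -> lin g -> lin_functional (fun x => f (g x)).
Proof. by move=> lf lg a x y; rewrite lg lf. Qed.

Lemma lin_bilinl (f : U -> V -> W) (g : T -> U) c :
  bilin f -> lin g -> lin (fun x => f (g x) c).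
Proof. by case=> l1 l2 lg a x y; rewrite lg l1. Qed.

Lemma lin_bilinr (f : U -> V -> W) (g : T -> V) c :
  bilin f -> lin g -> lin (fun x => f c (g x)).
Proof. by case=> l1 l2 lg a x y; rewrite lg l2. Qed.

Lemma lin_trilin1 (f : U -> V -> X -> W) (g : T -> U) c d :
  trilin f -> lin g -> lin (fun x => f (g x) c d).
Proof. by case=> l1 [l2 l3] lg a x y; rewrite lg l1. Qed.

Lemma lin_trilin2 (f : U -> V -> X -> W) (g : T -> V) c d :
  trilin f -> lin g -> lin (fun x => f c (g x) d).
Proof. by case=> l1 [l2 l3] lg a x y; rewrite lg l2. Qed.

Lemma lin_trilin3 (f : U -> V -> X -> W) (g : T -> X) c d :
  trilin f -> lin g -> lin (fun x => f c d (g x)).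
Proof. by case=> l1 [l2 l3] lg a x y; rewrite lg l3. Qed.

Lemma lin_scale_functional (f : T -> k) (w : W) :
  lin_functional f -> lin (fun x => f x *: w).
Proof. by move=> lf a x y; rewrite lf scalerDl scalerA. Qed.

Lemma lin_scale c (g : T -> W) : lin g -> lin (fun x => c *: g x).
Proof. by move=> lg a x y; rewrite lg scalerDr !scalerA mulrC. Qed.

Lemma lin_big I (r : seq I) (F : T -> I -> W) :
  (forall i, lin (F^~ i)) -> lin (fun x => \sum_(i <- r) F x i).
Proof.
move=> lF a x y; rewrite scaler_sumr -big_split /=.
by apply: eq_bigr => i _; apply: lF.
Qed.

Lemma lin_tsum_param (F : T -> U -> V -> W) s :
  (forall a b, lin (fun x => F x a b)) -> lin (fun x => tsum (F x) s).
Proof. by move=> lF; apply: lin_big => p; apply: lF. Qed.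
End Closure.

Section AlgebraClosure.
Variables (T : lmodType k) (A : algType k).

Lemma lin_mull (c : A) (g : T -> A) : lin g -> lin (fun x => c * g x).
Proof. by move=> lg a x y; rewrite lg mulrDr scalerAr. Qed.

Lemma lin_mulr (c : A) (g : T -> A) : lin g -> lin (fun x => g x * c).
Proof. by move=> lg a x y; rewrite lg mulrDl scalerAl. Qed.
End AlgebraClosure.
End Linearity.

Ltac lin_step :=
  first
  [ exact: lin_id
  | assumption
  | match goal with
    | H : lin ?f |- lin (fun x => ?f _) => apply: (lin_comp H)
    | H : lin_functional ?f |- lin_functional (fun x => ?f _) =>
        apply: (functional_comp H)
    | H : bilin ?f |- lin (fun x => ?f _ _) =>
        first [apply: (lin_bilinl _ H) | apply: (lin_bilinr _ H)]
    | H : trilin ?f |- lin (fun x => ?f _ _ _) =>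
        first [ apply: (lin_trilin1 _ _ H) | apply: (lin_trilin2 _ _ H)
              | apply: (lin_trilin3 _ _ H)]
    | |- lin (?f ?c) => change (lin (fun x => f c x))
    | |- bilin _ => apply: bilinP => ? /=
    | |- trilin _ => apply: trilinP => ? ? /=
    | |- lin (fun x => _ * _) => first [apply: lin_mull | apply: lin_mulr]
    | |- lin (fun x => _ *: _) => first [apply: lin_scale | apply: lin_scale_functional]
    end].

(** * Sweedler calculus and the antipode of a Hopf algebra *)

Section HopfAlgebra.
Variables (k : fieldType) (K : algType k) (Delta : K -> seq (K * K)).
Variables (eps : K -> k) (S : K -> K).
Hypothesis hopfK : is_hopf Delta eps S.

Lemma antipode_lin : lin S. Proof. by case: hopfK => _ _ _ _ []. Qed.

Lemma counit_lin : lin_functional eps. Proof. by case: hopfK => _ _ []. Qed.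

Lemma counit1 : eps 1 = 1. Proof. by case: hopfK => _ _ _ [_ [_ []]]. Qed.

Let lS := antipode_lin.
Let leps := counit_lin.

(** [Delta] takes values in lists, so its linearity makes sense only after pairing with a bilinear
    map. *)
Lemma lin_comul (T W : lmodType k) (f : K -> K -> W) (g : T -> K) :
  bilin f -> lin g -> lin (fun x => tsum f (Delta (g x))).
Proof.
case: hopfK => lD _ _ _ _ bf lg a x y; rewrite lg.
rewrite /tsum (lD a (g x) (g y) W f bf) big_cat big_map /=; congr (_ + _).
rewrite scaler_sumr; apply: eq_bigr => p _.
exact: (linZ (lin_bilinl _ bf (@lin_id _ _))).
Qed.

Ltac lins := repeat (intros; first
  [ apply: lin_comul | apply: lin_tsum_param | lin_step ]).

Lemma comul_coassoc (W : lmodType k) (f : K -> K -> K -> W) x : trilin f ->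
  tsum (fun p c => tsum (fun a b => f a b c) (Delta p)) (Delta x)
  = tsum (fun a p => tsum (f a) (Delta p)) (Delta x).
Proof.
case: hopfK => _ coK _ _ _ tf; have := coK x W f tf.
by rewrite !big_allpairs_dep.
Qed.

Lemma comulM (W : lmodType k) (f : K -> K -> W) x y : bilin f ->
  tsum f (Delta (x * y))
  = tsum (fun a b => tsum (fun c d => f (a * c) (b * d)) (Delta y)) (Delta x).
Proof.
case: hopfK => _ _ _ [DM _] _ bf; have := DM x y W f bf.
by rewrite big_allpairs_dep.
Qed.

Lemma comul1 (W : lmodType k) (f : K -> K -> W) : bilin f -> tsum f (Delta 1) = f 1 1.
Proof.
by case: hopfK => _ _ _ [_ [D1 _]] _ bf; rewrite /tsum D1 // big_seq1.
Qed.

Lemma counitl (W : lmodType k) (g : K -> W) x : lin g ->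
  tsum (fun a b => eps a *: g b) (Delta x) = g x.
Proof.
case: hopfK => _ _ [_ [cl _]] _ _ lg; rewrite -[in RHS](cl x) (lin_sum lg).
by apply: eq_bigr => p _; rewrite (linZ lg).
Qed.

Lemma counitr (W : lmodType k) (g : K -> W) x : lin g ->
  tsum (fun a b => eps b *: g a) (Delta x) = g x.
Proof.
case: hopfK => _ _ [_ [_ cr]] _ _ lg; rewrite -[in RHS](cr x) (lin_sum lg).
by apply: eq_bigr => p _; rewrite (linZ lg).
Qed.

Lemma antipodel (W : lmodType k) (g : K -> W) x : lin g ->
  tsum (fun a b => g (S a * b)) (Delta x) = eps x *: g 1.
Proof.
by case: hopfK => _ _ _ _ [_ [al _]] lg; rewrite -(linZ lg) -al (lin_sum lg).
Qed.

Lemma antipoder (W : lmodType k) (g : K -> W) x : lin g ->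
  tsum (fun a b => g (a * S b)) (Delta x) = eps x *: g 1.
Proof.
by case: hopfK => _ _ _ _ [_ [_ ar]] lg; rewrite -(linZ lg) -ar (lin_sum lg).
Qed.

Lemma antipode1 : S 1 = 1.
Proof.
have := antipodel 1 (@lin_id k K); rewrite comul1 ?mulr1; last by lins.
by rewrite counit1 scale1r.
Qed.

Lemma counitM x y : eps (x * y) = eps x * eps y.
Proof. by case: hopfK => _ _ _ [_ [_ [eM _]]] _; apply: eM. Qed.

Let antipode_mull (W : lmodType k) (g : K -> W) x y : lin g ->
  tsum (fun a b => tsum (fun u v => g (S (a * u) * (b * v))) (Delta y)) (Delta x)
  = (eps x * eps y) *: g 1.
Proof.
move=> lg; rewrite -counitM -antipodel // comulM //.
by lins.
Qed.

Let antipode_mulr (W : lmodType k) (g : K -> W) x y : lin g ->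
  tsum (fun b c => tsum (fun v w => g (b * v * (S w * S c))) (Delta y)) (Delta x)
  = (eps x * eps y) *: g 1.
Proof.
move=> lg; transitivity (tsum (fun b c => eps y *: g (b * S c)) (Delta x)).
  apply: eq_tsum => b c; rewrite -[b in RHS]mulr1.
  rewrite -(antipoder (g := fun z => g (b * z * S c))); last by lins.
  by apply: eq_tsum => v w; rewrite !mulrA.
by rewrite (antipoder (g := fun z => eps y *: g z)) ?scalerA //; lins.
Qed.

(* Both sides are convolution inverses of the product, as maps from K (x) K to K. *)
Lemma antipodeM x y : S (x * y) = S y * S x.
Proof.
(* Summed over the threefold coproducts of [x] and [y], [F] collapses to [S (x * y)] when its last
   factors cancel and to [S y * S x] when its first ones do. *)
pose F a b c u v w : K := S (a * u) * ((b * v) * (S w * S c)).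
transitivity (tsum (fun a p => tsum (fun b c =>
  tsum (fun u q => tsum (fun v w => F a b c u v w) (Delta q)) (Delta y))
  (Delta p)) (Delta x)).
- rewrite -(counitr (g := fun z => S (z * y)) x); last by lins.
  apply: eq_tsum => a p; rewrite -(counitr (g := fun z => S (a * z)) y); last by lins.
  rewrite (lin_tsum _ _ (lin_scale _ (@lin_id _ _))) tsum_exchange.
  apply: eq_tsum => u q; rewrite /F (antipode_mulr (g := fun z => S (a * u) * z)).
    by rewrite mulr1 scalerA.
  by lins.
transitivity (tsum (fun a p => tsum (fun b c =>
  tsum (fun q w => tsum (fun u v => F a b c u v w) (Delta q)) (Delta y))
  (Delta p)) (Delta x)).
  by do 2!apply: eq_tsum => ? ?; rewrite comul_coassoc // /F; lins.
rewrite -comul_coassoc /F; last by lins.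
rewrite -(counitl (g := fun z => S y * S z)); last by lins.
apply: eq_tsum => p c; rewrite tsum_exchange.
rewrite -(counitl (g := fun z => S z * S c)); last by lins.
rewrite (lin_tsum _ _ (lin_scale _ (@lin_id _ _))).
apply: eq_tsum => q w.
transitivity (tsum (fun a b => tsum (fun u v =>
   S (a * u) * (b * v) * (S w * S c)) (Delta q)) (Delta p)).
  by do 2!apply: eq_tsum => ? ?; rewrite !mulrA.
rewrite (antipode_mull (g := fun z => z * (S w * S c))) ?mul1r ?scalerA //.
by lins.
Qed.

(** Coassociativity regroups the fourfold coproduct so that the two middle legs come from one
    element, where the antipode axiom leaves a counit. *)
Lemma antipodel_middle (W : lmodType k) (G : K -> K -> K -> W) z : trilin G ->
  tsum (fun p q => tsum (fun a b => tsum (fun c d => G a (S b * c) d) (Delta q))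
    (Delta p)) (Delta z)
  = tsum (fun a d => G a 1 d) (Delta z).
Proof.
move=> tG; rewrite (comul_coassoc (f := fun a b q =>
  tsum (fun c d => G a (S b * c) d) (Delta q))); last by lins.
apply: eq_tsum => a p; rewrite -(comul_coassoc (f := fun b c d => G a (S b * c) d));
  last by lins.
rewrite -(counitl (g := G a 1)); last by lins.
by apply: eq_tsum => q d; rewrite (antipodel (g := fun y => G a y d)) //; lins.
Qed.

Lemma antipoder_middle (W : lmodType k) (G : K -> K -> K -> W) z : trilin G ->
  tsum (fun p q => tsum (fun a b => tsum (fun c d => G a (b * S c) d) (Delta q))
    (Delta p)) (Delta z)
  = tsum (fun a d => G a 1 d) (Delta z).
Proof.
move=> tG; rewrite (comul_coassoc (f := fun a b q =>
  tsum (fun c d => G a (b * S c) d) (Delta q))); last by lins.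
apply: eq_tsum => a p; rewrite -(comul_coassoc (f := fun b c d => G a (b * S c) d));
  last by lins.
rewrite -(counitl (g := G a 1)); last by lins.
by apply: eq_tsum => q d; rewrite (antipoder (g := fun y => G a y d)) //; lins.
Qed.

(* Both sides are convolution inverses of the coproduct, as maps from K to K (x) K. *)
Lemma comul_antipode (W : lmodType k) (f : K -> K -> W) z : bilin f ->
  tsum f (Delta (S z)) = tsum (fun a b => f (S b) (S a)) (Delta z).
Proof.
move=> bf; pose g c u v := tsum (fun s t => f (u * S t) (v * S s)) (Delta c).
have bg c : bilin (g c) by rewrite /g; lins.
(* [T a b c] is [f] applied to Delta(S a) Delta(b) (S(c_2) (x) S(c_1)). Cancelling [b] against [c]
   leaves the left side of the claim; cancelling [a] against [b] leaves the right side. *)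
pose T a b c := tsum (fun x y => tsum (fun u v => g c (x * u) (y * v))
  (Delta b)) (Delta (S a)).
have tT : trilin T by rewrite /T /g; lins.
transitivity (tsum (fun a p => tsum (T a) (Delta p)) (Delta z)).
  rewrite -(counitr (g := fun y => tsum f (Delta (S y)))); last by lins.
  apply: eq_tsum => a p; rewrite (lin_tsum _ _ (lin_scale _ (@lin_id _ _))).
  rewrite /T tsum_exchange; apply: eq_tsum => x y.
  transitivity (tsum (fun b d => f (x * b * S d) (y * 1)) (Delta p)); last first.
    rewrite -(antipoder_middle (G := fun b c d => f (x * b * S d) (y * c)));
      last by lins.
    by rewrite /g; do 3!apply: eq_tsum => ? ?; rewrite mulrA.
  rewrite mulr1 -[x in LHS]mulr1 -(antipoder (g := fun c => f (x * c) y));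
    last by lins.
  by apply: eq_tsum => b c; rewrite mulrA.
rewrite -comul_coassoc //.
rewrite -(counitl (g := fun y => tsum (fun a b => f (S b) (S a)) (Delta y)));
  last by lins.
apply: eq_tsum => p c.
transitivity (tsum (fun a b => tsum (g c) (Delta (S a * b))) (Delta p)).
  by apply: eq_tsum => a b; rewrite comulM.
rewrite (antipodel (g := fun y => tsum (g c) (Delta y))); last by lins.
by rewrite comul1 // /g; congr (_ *: _); apply: eq_tsum => s t; rewrite !mul1r.
Qed.

(** * Matrices of comodules, inverted by the antipode *)

Definition comatrix m (M : 'I_m -> 'I_m -> K) : Prop :=
  (forall (W : lmodType k) (f : K -> K -> W) i j, bilin f ->
    tsum f (Delta (M i j)) = \sum_s f (M i s) (M s j)) /\
  (forall i j, eps (M i j) = (i == j)%:R).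

Lemma comatrix_antipodel m (M : 'I_m -> 'I_m -> K) i j : comatrix M ->
  \sum_s S (M i s) * M s j = (i == j)%:R.
Proof.
case=> DM eM; have := antipodel (M i j) (@lin_id _ _); rewrite DM; last by lins.
by move=> ->; rewrite eM scaler_nat.
Qed.

Lemma comatrix_antipoder m (M : 'I_m -> 'I_m -> K) i j : comatrix M ->
  \sum_s M i s * S (M s j) = (i == j)%:R.
Proof.
case=> DM eM; have := antipoder (M i j) (@lin_id _ _); rewrite DM; last by lins.
by move=> ->; rewrite eM scaler_nat.
Qed.

(** The matrix of the [S (M i j)] is a left inverse of [M] and [N] is a right inverse, so they agree
    even over a noncommutative [K]. *)
Lemma comatrix_antipode_inv m (M N : 'I_m -> 'I_m -> K) : comatrix M ->
  (forall i j, \sum_s M i s * N s j = (i == j)%:R) ->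
  forall i j, S (M i j) = N i j.
Proof.
move=> cM MN i j.
transitivity (\sum_s S (M i s) * (s == j)%:R).
  by rewrite (bigD1 j) //= eqxx mulr1 big1 ?addr0 // => s /negPf->; rewrite mulr0.
under eq_bigr do rewrite -MN mulr_sumr.
rewrite exchange_big /=.
under eq_bigr => t _ do
  (under eq_bigr do rewrite mulrA; rewrite -mulr_suml (comatrix_antipodel _ _ cM)).
rewrite (bigD1 i) //= eqxx mul1r big1 ?addr0 // => s; rewrite eq_sym => /negPf->.
by rewrite mul0r.
Qed.

(** * The Hopf subalgebra generated by a subset *)

Section GeneratedSubalgebra.
Variable X : K -> Prop.

Inductive generated : K -> Prop :=
| gen_mem x of X x : generated x
| gen_one : generated 1
| gen_lin a x y of generated x & generated y : generated (a *: x + y)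
| gen_mul x y of generated x & generated y : generated (x * y).

(** Stability under [S] and [Delta] passes from the generators to all elements because [S] is
    antimultiplicative and [Delta] is multiplicative. *)
Lemma generated_hopf_subalg :
  (forall x, X x -> X (S x)) ->
  (forall x, X x -> exists s, teq (Delta x) s /\ forall p, p \in s -> X p.1 /\ X p.2) ->
  is_hopf_subalg Delta S generated.
Proof.
move=> XS XD; split; [exact: gen_one | exact: gen_lin | exact: gen_mul | |].
- move=> x; elim=> {x} [x /XS/gen_mem // | | a x y _ gx _ gy | x y _ gx _ gy].
  + by rewrite antipode1; apply: gen_one.
  + by rewrite antipode_lin; apply: gen_lin.
  + by rewrite antipodeM; apply: gen_mul.
- case: hopfK => DL _ _ [DM [D1 _]] _.
  move=> x; elim=> {x} [x | | a x y _ [s [Ds gs]] _ [t [Dt gt]]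
                       | x y _ [s [Ds gs]] _ [t [Dt gt]]].
  + case/XD=> s [Ds Xs]; exists s; split=> // p /Xs[X1 X2].
    by split; apply: gen_mem.
  + exists [:: (1, 1)]; split=> // p; rewrite inE => /eqP->.
    by split; apply: gen_one.
  + exists ([seq (a *: p.1, p.2) | p <- s] ++ t); split.
      move=> W f bf; rewrite (DL a x y W f bf) !big_cat !big_map /=; congr (_ + _).
        transitivity (a *: tsum f (Delta x)); last first.
          rewrite /tsum Ds // scaler_sumr; apply: eq_bigr => p _ /=.
          by rewrite (linZ (lin_bilinl p.2 bf (@lin_id _ _))).
        rewrite scaler_sumr; apply: eq_bigr => p _ /=.
        by rewrite (linZ (lin_bilinl p.2 bf (@lin_id _ _))).
      exact: Dt.
    move=> p; rewrite mem_cat => /orP[/mapP[q /gs[g1 g2] ->]|/gt//]; split=> //=.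
    (* [gen_lin] has no pure scaling, so [a *: q.1] is obtained by adding 0 in the form
       [-1 *: q.1 + q.1]. *)
    have := gen_lin a g1 (gen_lin (-1) g1 g1).
    by rewrite scaleN1r addNr addr0.
  + exists [seq (p.1 * q.1, p.2 * q.2) | p <- s, q <- t]; split.
      move=> W f bf; rewrite (DM x y W f bf) !big_allpairs_dep /=.
      transitivity (tsum (fun a b => tsum (fun c d => f (a * c) (b * d)) (Delta y)) s).
        by apply: Ds; lins.
      by apply: eq_bigr => p _; apply: Dt; lins.
    move=> p /allpairsP[[q r] /= [/gs[g1 g2] /gt[h1 h2] ->]] /=.
    by split; apply: gen_mul.
Qed.

(** [S] reverses products, so [S] applied twice is an algebra endomorphism, and its fixed points
    form a subalgebra. *)
Lemma generated_antipode_involutive :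
  (forall x, X x -> S (S x) = x) -> forall x, generated x -> S (S x) = x.
Proof.
move=> XS x; elim=> {x} [x /XS // | | a x y _ Sx _ Sy | x y _ Sx _ Sy].
- by rewrite !antipode1.
- by rewrite !antipode_lin Sx Sy.
- by rewrite !antipodeM Sx Sy.
Qed.
End GeneratedSubalgebra.

(** * Matrix coefficients of a comodule algebra *)

Section Coaction.
Variables (E : falgType k) (rho : E -> seq (K * E)).
Hypothesis comodE : is_comod_alg Delta eps rho.

Lemma lin_coact (T W : lmodType k) (f : K -> E -> W) (g : T -> E) :
  bilin f -> lin g -> lin (fun x => tsum f (rho (g x))).
Proof.
case: comodE => lrho _ _ _ _ bf lg a x y; rewrite lg.
rewrite /tsum (lrho a (g x) (g y) W f bf) big_cat big_map /=; congr (_ + _).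
rewrite scaler_sumr; apply: eq_bigr => p _.
exact: (linZ (lin_bilinl _ bf (@lin_id _ _))).
Qed.

(** The matrix coefficient (id (x) xi)(rho x) of the comodule [E]. *)
Definition coef (xi : E -> k) (x : E) : K := tsum (fun a b => xi b *: a) (rho x).

Lemma coef_lin xi : lin_functional xi -> lin (coef xi).
Proof. by move=> lxi; apply: lin_coact => //; lins. Qed.

Lemma comul_coef (W : lmodType k) (f : K -> K -> W) xi x :
  lin_functional xi -> bilin f ->
  tsum f (Delta (coef xi x)) = tsum (fun a b => f a (coef xi b)) (rho x).
Proof.
move=> lxi bf; rewrite (lin_tsum _ _ (lin_comul bf (@lin_id _ _))).
case: comodE => _ coE _ _ _.
have := coE x W (fun a b z => xi z *: f a b); rewrite !big_allpairs_dep /= => coEx.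
transitivity (tsum (fun a z => tsum (fun b c => xi z *: f b c) (Delta a)) (rho x)).
  apply: eq_tsum => a z; rewrite (linZ (lin_comul bf (@lin_id _ _))).
  by rewrite (lin_tsum _ _ (lin_scale _ (@lin_id _ _))).
rewrite /tsum coEx; last by lins.
apply: eq_bigr => p _; rewrite (lin_tsum _ _ (lin_bilinr p.1 bf (@lin_id _ _))).
by apply: eq_bigr => q _; rewrite (linZ (lin_bilinr p.1 bf (@lin_id _ _))).
Qed.

Lemma counit_coef xi x : lin_functional xi -> eps (coef xi x) = xi x.
Proof.
move=> lxi; case: comodE => _ _ cE _ _.
rewrite /coef (lin_tsum (W := k^o) _ _ leps) -[in RHS](cE x).
rewrite (lin_sum (W := k^o) lxi); apply: eq_bigr => p _.
rewrite (linZ (W := k^o) leps) (linZ (W := k^o) lxi).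
exact: mulrC.
Qed.

Section Coefficients.
Variables (U : {vspace E}) (m : nat) (xi : 'I_m -> E -> k) (e : 'I_m -> E).
Hypothesis Ucomod :
  forall x, x \in U -> exists s, teq (rho x) s /\ forall p, p \in s -> p.2 \in U.
Hypothesis xi_lin : forall i, lin_functional (xi i).
Hypothesis eU : forall i, e i \in U.
Hypothesis e_span : forall x, x \in U -> x = \sum_i xi i x *: e i.
Hypothesis xi_e : forall i j, xi i (e j) = (i == j)%:R.

(** [rho x] has a representative with second legs in [U]; these expand in the [e i], and collecting
    terms turns the first legs into coefficients. *)
Lemma coact_expand (W : lmodType k) (f : K -> E -> W) x : x \in U -> bilin f ->
  tsum f (rho x) = \sum_i f (coef (xi i) x) (e i).
Proof.
move=> Ux bf; have [s [rs sU]] := Ucomod Ux.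
transitivity (tsum f s); first exact: rs.
transitivity (\sum_(p <- s) \sum_i xi i p.2 *: f p.1 (e i)).
  rewrite /tsum big_seq [RHS]big_seq; apply: eq_bigr => p /sU/e_span {1}->.
  rewrite (lin_sum (lin_bilinr p.1 bf (@lin_id _ _))); apply: eq_bigr => i _.
  by rewrite (linZ (lin_bilinr p.1 bf (@lin_id _ _))).
rewrite exchange_big; apply: eq_bigr => i _.
have li := xi_lin i.
have -> : coef (xi i) x = tsum (fun a b => xi i b *: a) s by apply: rs; lins.
rewrite (lin_sum (lin_bilinl (e i) bf (@lin_id _ _))); apply: eq_bigr => p _.
by rewrite (linZ (lin_bilinl (e i) bf (@lin_id _ _))).
Qed.

Lemma coef_comatrix : comatrix (fun i j => coef (xi j) (e i)).
Proof.
split=> [W f i j bf | i j]; last by rewrite counit_coef // xi_e eq_sym.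
have lj := coef_lin (xi_lin j).
by rewrite comul_coef // coact_expand //; lins.
Qed.
End Coefficients.
End Coaction.
End HopfAlgebra.

(** * Dual bases for a pairing of two subspaces *)

Section DualBases.
Variables (k : fieldType) (E : vectType k) (B : E -> E -> k).
Hypothesis linBl : forall y, lin_functional (B^~ y).
Hypothesis linBr : forall x, lin_functional (B x).

(** Left nondegeneracy makes the Gram matrix of two bases row free, and a right inverse of it turns
    the basis of [V] into a family [f] dual to [e]. That [f] spans [V] comes from right
    nondegeneracy, not from comparing dimensions. *)
Lemma dual_bases (U V : {vspace E}) :
  (forall x, x \in U -> (forall y, y \in V -> B x y = 0) -> x = 0) ->
  (forall y, y \in V -> (forall x, x \in U -> B x y = 0) -> y = 0) ->
  exists (m : nat) (e f : 'I_m -> E),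
    [/\ forall i, e i \in U, forall i, f i \in V,
        forall i j, B (e i) (f j) = (i == j)%:R,
        forall x, x \in U -> x = \sum_i B x (f i) *: e i &
        forall y, y \in V -> y = \sum_i B (e i) y *: f i].
Proof.
move=> ndl ndr; pose e (i : 'I_(\dim U)) := (vbasis U)`_i.
pose g (i : 'I_(\dim V)) := (vbasis V)`_i.
have eU i : e i \in U by apply/vbasis_mem/mem_nth; rewrite size_tuple.
have gV i : g i \in V by apply/vbasis_mem/mem_nth; rewrite size_tuple.
pose M := \matrix_(i, j) B (e i) (g j).
have /row_freeP[N MN] : row_free M.
  apply/inj_row_free => v vM; pose x := \sum_i v 0 i *: e i.
  have x0 : x = 0.
    apply: ndl => [|y Vy]; first by apply: rpred_sum => i _; apply: rpredZ.
    rewrite (coord_vbasis Vy) (lin_sum (W := k^o) (linBr x)) big1 // => j _.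
    rewrite (linZ (W := k^o) (linBr x)) -/(g j) (lin_sum (W := k^o) (linBl _)).
    have /matrixP/(_ 0 j) := vM; rewrite !mxE => vMj.
    transitivity (coord (vbasis V) j y *: (0 : k^o)); last exact: scaler0.
    congr (_ *: _); rewrite -[RHS]vMj; apply: eq_bigr => i _.
    by rewrite (linZ (W := k^o) (linBl _)) mxE.
  apply/rowP=> i; rewrite mxE.
  by have /freeP := basis_free (vbasisP U); apply; exact: x0.
pose f j := \sum_i N i j *: g i.
have fV i : f i \in V by apply: rpred_sum => j _; apply: rpredZ.
have ef i j : B (e i) (f j) = (i == j)%:R.
  rewrite (lin_sum (W := k^o) (linBr _)).
  have /matrixP/(_ i j) := MN; rewrite !mxE => <-; apply: eq_bigr => l _.
  by rewrite (linZ (W := k^o) (linBr _)) mxE mulrC.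
have eE x : x \in U -> x = \sum_i B x (f i) *: e i.
  move=> Ux; rewrite {1}(coord_vbasis Ux); apply: eq_bigr => i _; congr (_ *: _).
  rewrite {2}(coord_vbasis Ux) (lin_sum (W := k^o) (linBl _)) (bigD1 i) //=.
  rewrite (linZ (W := k^o) (linBl _)) ef eqxx /= [_ *: _]mulr1 big1 ?addr0 //.
  move=> j /negPf ji; rewrite (linZ (W := k^o) (linBl _)) ef ji.
  exact: scaler0.
exists (\dim U), e, f; split=> // y Vy; apply/eqP; rewrite -subr_eq0; apply/eqP.
apply: ndr => [|x Ux]; first by rewrite rpredB // rpred_sum // => i _; apply: rpredZ.
have Be i : B (e i) (y - \sum_j B (e j) y *: f j) = 0.
  rewrite addrC -scaleN1r linBr (lin_sum (W := k^o) (linBr _)) (bigD1 i) //=.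
  rewrite (linZ (W := k^o) (linBr _)) ef eqxx big1 => [|j /negPf ij].
    by rewrite addr0 mulN1r [_ *: _]mulr1 addNr.
  by rewrite (linZ (W := k^o) (linBr _)) ef eq_sym ij; apply: scaler0.
rewrite (eE x Ux) (lin_sum (W := k^o) (linBl _)) big1 // => i _.
by rewrite (linZ (W := k^o) (linBl _)) Be; apply: scaler0.
Qed.
End DualBases.

(** * The graded Frobenius form and its coinvariance *)

Section GradedFrobenius.
Variables (k : fieldType) (E : falgType k) (Eg : nat -> {vspace E}).
Variable B : E -> E -> k.
Hypothesis grE : is_conn_graded Eg.
Hypothesis frobB : is_graded_frobenius_form Eg B.

Lemma frobenius_linl y : lin_functional (B^~ y).
Proof. by case: frobB => [[lB _] _ _ _] a x x'; apply: lB. Qed.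

Lemma frobenius_linr x : lin_functional (B x).
Proof. by case: frobB => [[_ lB] _ _ _] a y y'; apply: lB. Qed.

Lemma graded_functional_eq0 (W : lmodType k) (g : E -> W) :
  lin g -> (forall i x, x \in Eg i -> g x = 0) -> forall x, g x = 0.
Proof.
move=> lg g0 x; case: grE => _ [n Ef] _ _.
have : x \in (\sum_(i < n) Eg i)%VS by rewrite Ef memvf.
case/memv_sumP=> v vE ->; rewrite (lin_sum lg) big1 // => i _.
by apply: (g0 i); apply: vE.
Qed.

Lemma frobenius_nondegl x : (forall j y, y \in Eg j -> B x y = 0) -> x = 0.
Proof.
case: frobB => _ _ [nd _] _ Bx; apply: nd.
exact: (graded_functional_eq0 (W := k^o) (frobenius_linr x) Bx).
Qed.

Lemma frobenius_nondegr y : (forall i x, x \in Eg i -> B x y = 0) -> y = 0.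
Proof.
case: frobB => _ _ [_ nd] _ By; apply: nd.
exact: (graded_functional_eq0 (W := k^o) (frobenius_linl y) By).
Qed.

(** The form pairs degree i only with degree d - i. Since 1 has degree 0 and pairs nontrivially with
    something, E_d is nonzero; a degree beyond d has no partner. *)
Lemma frobenius_top_degree : exists d : nat,
  [/\ forall i j x y, x \in Eg i -> y \in Eg j -> (i + j != d)%N -> B x y = 0,
      Eg d != 0%VS & forall i, (d < i)%N -> Eg i = 0%VS].
Proof.
have [_ _ _ [d Bd]] := frobB; have [_ _ _ E0] := grE; exists d; split=> //.
- apply/eqP=> Ed0; have /eqP[] := oner_neq0 E; apply: frobenius_nondegl => j y jy.
  have [jd | jd] := eqVneq j d.
    by move: jy; rewrite jd Ed0 memv0 => /eqP->; apply: (lin0 (W := k^o) (frobenius_linr 1)).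
  by apply: (Bd 0%N j) => //; rewrite E0 memv_line.
- move=> i di; apply/eqP; rewrite -subv0; apply/subvP=> x ix; rewrite memv0.
  apply/eqP/frobenius_nondegl => j y jy; apply: (Bd i j) => //.
  by rewrite neq_ltn (leq_trans di) ?leq_addr ?orbT.
Qed.

(* The degree complementary to 1; if the top degree is 0 then E_1 = 0 and 1 itself will do. *)
Lemma frobenius_complement_degree1 : exists j : nat,
  (forall x, x \in Eg 1%N -> (forall y, y \in Eg j -> B x y = 0) -> x = 0) /\
  (forall y, y \in Eg j -> (forall x, x \in Eg 1%N -> B x y = 0) -> y = 0).
Proof.
have [[|d] [Bd _ Etop]] := frobenius_top_degree.
  exists 1%N; rewrite Etop //.
  by split=> x; rewrite memv0 => /eqP.
exists d; split=> [x Ex Bx | y Ey By].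
  apply: frobenius_nondegl => j y jy; have [jd|jd] := eqVneq j d.
    by apply: Bx; rewrite -jd.
  by apply: (Bd 1%N j).
apply: frobenius_nondegr => i x ix; have [i1|i1] := eqVneq i 1%N.
  by apply: By; rewrite -i1.
by apply: (Bd i d); rewrite // -add1n eqn_add2r.
Qed.

Variables (K : algType k) (rho : E -> seq (K * E)).
Hypothesis rho_lin : forall (W : lmodType k) (f : K -> E -> W),
  bilin f -> lin (fun x => tsum f (rho x)).
Hypothesis rho_graded : forall i x, x \in Eg i ->
  exists s, teq (rho x) s /\ forall p, p \in s -> p.2 \in Eg i.
Hypothesis codet_trivial : forall d, Eg d != 0%VS ->
  (forall i, (d < i)%N -> Eg i = 0%VS) ->
  forall e, e \in Eg d -> e != 0 -> teq (rho e) [:: (1, e)].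

(** The functional [B^~ 1] vanishes outside degree d. Off that degree both sides are zero because
    the coaction is graded; in degree d the trivial codeterminant makes [rho x] equal to 1 (x) x. *)
Lemma frobenius_functional_invariant x :
  tsum (fun a z => B z 1 *: a) (rho x) = B x 1 *: 1.
Proof.
have [d [Bd Ed Etop]] := frobenius_top_degree; have [_ _ _ E0] := grE.
have l1 := frobenius_linl 1.
have bB : bilin (fun (a : K) z => B z 1 *: a) by repeat (intros; lin_step).
apply/eqP; rewrite -subr_eq0; apply/eqP; move: x.
apply: graded_functional_eq0 => [a x y | i x ix].
  by rewrite (rho_lin bB) l1 scalerDl scalerBr -scalerA opprD addrACA.
have [id | id] := eqVneq i d; last first.
  have B1 y : y \in Eg i -> B y 1 = 0.
    by move=> iy; apply: (Bd i 0%N) => //; rewrite ?addn0 // E0 memv_line.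
  have [s [rs sE]] := rho_graded ix.
  have -> : tsum (fun a z => B z 1 *: a) (rho x) = tsum (fun a z => B z 1 *: a) s.
    exact: rs.
  rewrite B1 // scale0r subr0 /tsum big_seq big1 // => p /sE/B1 ->.
  by rewrite scale0r.
have [-> | x0] := eqVneq x 0.
  by rewrite (lin0 (rho_lin bB)) (lin0 (W := k^o) l1) scale0r subr0.
rewrite id in ix; have rx := codet_trivial Ed Etop ix x0.
have -> : tsum (fun a z => B z 1 *: a) (rho x)
        = tsum (fun a z => B z 1 *: a) [:: (1, x)] by exact: rx.
by rewrite /tsum big_seq1 subrr.
Qed.
End GradedFrobenius.

(** * The square of the antipode is the identity *)

Section AntipodeSquare.
Variables (k : fieldType) (E : falgType k) (Eg : nat -> {vspace E}).
Variables (B : E -> E -> k) (K : algType k) (Delta : K -> seq (K * K)).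
Variables (eps : K -> k) (S : K -> K) (rho : E -> seq (K * E)).
Hypothesis grE : is_conn_graded Eg.
Hypothesis frobB : is_graded_frobenius_form Eg B.
Hypothesis nakayama_scalar : exists mu : E -> E, is_nakayama B mu /\
  exists lam : k, forall a, a \in Eg 1%N -> mu a = lam *: a.
Hypothesis hopfK : is_hopf Delta eps S.
Hypothesis comodE : is_comod_alg Delta eps rho.
Hypothesis rho_graded : forall i x, x \in Eg i ->
  exists s, teq (rho x) s /\ forall p, p \in s -> p.2 \in Eg i.
Hypothesis inner_faithful : forall K' : K -> Prop,
  is_hopf_subalg Delta S K' -> (exists x, ~ K' x) ->
  exists e, e \in Eg 1%N /\ ~ (exists s, teq (rho e) s /\
    forall p, p \in s -> K' p.1 /\ p.2 \in Eg 1%N).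
Hypothesis codet_trivial : forall d, Eg d != 0%VS ->
  (forall i, (d < i)%N -> Eg i = 0%VS) ->
  forall e, e \in Eg d -> e != 0 -> teq (rho e) [:: (1, e)].

(** Associativity gives B(z,w) = B(zw,1) and [rho] is multiplicative, so this is the coinvariance of
    [B^~ 1] at [x * y]. *)
Lemma frobenius_coact x y :
  tsum (fun a z => tsum (fun b w => B z w *: (a * b)) (rho y)) (rho x)
  = B x y *: 1.
Proof.
have [_ Bassoc _ _] := frobB; have l1 := frobenius_linl frobB 1.
have [_ _ _ rhoM _] := comodE.
have inv := frobenius_functional_invariant grE frobB
  (fun W f bf => lin_coact comodE bf (@lin_id _ _)) rho_graded codet_trivial (x * y).
rewrite -[y in RHS]mulr1 -Bassoc -{}inv.
have bB : bilin (fun (a : K) z => B z 1 *: a) by repeat (intros; lin_step).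
have := rhoM x y K _ bB; rewrite big_allpairs_dep /= => rxy.
transitivity (\sum_(p <- rho x) \sum_(q <- rho y) B (p.2 * q.2) 1 *: (p.1 * q.1)).
  by apply: eq_bigr => p _; apply: eq_bigr => q _; rewrite Bassoc mulr1.
by rewrite -rxy.
Qed.

Lemma antipode_involutive x : S (S x) = x.
Proof.
have [j [ndl ndr]] := frobenius_complement_degree1 grE frobB.
have linBl := frobenius_linl frobB; have linBr := frobenius_linr frobB.
have [m [e [f [eU fV ef eE fE]]]] := dual_bases linBl linBr ndl ndr.
pose Y i s := coef rho (B^~ (f s)) (e i).
pose G i s := coef rho (B (e s)) (f i).
have fe i s : B (e i) (f s) = (s == i)%:R by rewrite ef eq_sym.
have cY : comatrix Delta eps Y.
  by apply: (coef_comatrix hopfK comodE (U := Eg 1%N) (xi := fun s => B^~ (f s))) => //;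
     apply: rho_graded.
have cG : comatrix Delta eps G.
  by apply: (coef_comatrix hopfK comodE (U := Eg j) (xi := fun s => B (e s))) => //;
     apply: rho_graded.
have expY (W : lmodType k) (g : K -> E -> W) i : bilin g ->
    tsum g (rho (e i)) = \sum_s g (Y i s) (e s).
  by apply: (coact_expand (@rho_graded 1%N) (xi := fun s => B^~ (f s))).
have expG (W : lmodType k) (g : K -> E -> W) i : bilin g ->
    tsum g (rho (f i)) = \sum_s g (G i s) (f s).
  by apply: (coact_expand (@rho_graded j) (xi := fun s => B (e s))).
have bB (a : K) z : bilin (fun b w => B z w *: (a * b)).
  by repeat (intros; first [exact: linBr | lin_step]).
have YG i l : \sum_s Y i s * G l s = (i == l)%:R.
  have := frobenius_coact (e i) (f l); rewrite ef scaler_nat => <-.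
  rewrite expY; last by repeat (intros;
    first [exact: linBl | apply: lin_tsum_param | lin_step]).
  apply: eq_bigr => s _; rewrite expG //.
  rewrite (bigD1 s) //= ef eqxx scale1r big1 ?addr0 // => t /negPf ts.
  by rewrite ef eq_sym ts scale0r.
have [mu [nak [lam mu1]]] := nakayama_scalar.
(* By the Nakayama identity, swapping the arguments costs only the scalar [lam], so up to [lam] the
   two bases are dual in the reversed order as well. *)
have Bfe i l : lam * B (f l) (e i) = (i == l)%:R.
  by rewrite -ef [RHS]nak mu1 // (linZ (W := k^o) (linBr _)).
have GY i l : \sum_s G i s * Y l s = (i == l)%:R.
  have := congr1 (fun z => lam *: z) (frobenius_coact (f i) (e l)).
  rewrite scalerA Bfe scaler_nat eq_sym => <-.
  rewrite expG; last by repeat (intros;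
    first [exact: linBl | apply: lin_tsum_param | lin_step]).
  rewrite scaler_sumr; apply: eq_bigr => s _; rewrite expY // scaler_sumr.
  rewrite (bigD1 s) //= scalerA Bfe eqxx scale1r big1 ?addr0 // => t /negPf ts.
  by rewrite scalerA Bfe ts scale0r.
have SY i l : S (Y i l) = G l i.
  exact: (comatrix_antipode_inv hopfK (N := fun i l => G l i) cY YG).
have SG i l : S (G i l) = Y l i.
  exact: (comatrix_antipode_inv hopfK (N := fun i l => Y l i) cG GY).
(* [S] exchanges the entries of [Y] with those of [G], so taking both makes the set stable under
   [S]. *)
pose X z := exists i l, z = Y i l \/ z = G i l.
have hopfX : is_hopf_subalg Delta S (generated X).
  apply: (generated_hopf_subalg hopfK) => z [i [l [] ->]].
  - by exists l, i; right; rewrite SY.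
  - by exists l, i; left; rewrite SG.
  - exists [seq (Y i s, Y s l) | s <- index_enum 'I_m]; split.
      by move=> W g bg; rewrite big_map; apply: (proj1 cY).
    move=> p /mapP[s _ ->] /=; split; [exists i, s | exists s, l]; by left.
  - exists [seq (G i s, G s l) | s <- index_enum 'I_m]; split.
      by move=> W g bg; rewrite big_map; apply: (proj1 cG).
    move=> p /mapP[s _ ->] /=; split; [exists i, s | exists s, l]; by right.
(* An element moved by [S] twice would make the generated subalgebra proper, against inner
   faithfulness, since the coefficients of [rho] on E_1 lie in it. *)
case: (S (S x) =P x) => // SSx; exfalso.
have [|e1 [Ee1 []]] := inner_faithful hopfX.
  exists x => /(generated_antipode_involutive hopfK); apply: contra_not SSx; apply.
  by move=> z [i [l [] ->]]; rewrite ?(SY, SG).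
exists [seq (coef rho (B^~ (f s)) e1, e s) | s <- index_enum 'I_m]; split.
  move=> W g bg; rewrite big_map /=.
  exact: (coact_expand (@rho_graded 1%N) (xi := fun s => B^~ (f s))).
move=> p /mapP[s _ ->] /=; split=> //.
rewrite (eE e1 Ee1) (lin_sum (coef_lin comodE (linBl _))).
have gen0 : generated X 0.
  have := gen_lin (-1) (gen_one X) (gen_one X).
  by rewrite scaleN1r addNr.
apply: big_rec => // i z _ gz; rewrite (linZ (coef_lin comodE (linBl _))).
by apply: gen_lin => //; apply: gen_mem; exists i, s; left.
Qed.
End AntipodeSquare.

(** * Coordinate functionals of a finite-dimensional space *)

Lemma fin_dim_coords (k : fieldType) (V : lmodType k) n : fin_dim_with V n ->
  exists (b : 'I_n -> V) (xi : 'I_n -> V -> k),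
    [/\ forall i, lin_functional (xi i), forall x, x = \sum_i xi i x *: b i &
        forall i j, xi i (b j) = (i == j)%:R].
Proof.
case=> b [bfree bspan].
(* Coefficients are stored as finite functions, which form a choice type, so that [xchoose] selects
   them; freeness then makes the selection linear. *)
have ex x : exists c : {ffun 'I_n -> k}, x == \sum_i c i *: b i.
  have [c xE] := bspan x; exists [ffun i => c i]; apply/eqP.
  by rewrite [LHS]xE; apply: eq_bigr => i _; rewrite ffunE.
pose xi i x := xchoose (ex x) i.
have xiE x : x = \sum_i xi i x *: b i by apply/eqP/(xchooseP (ex x)).
have uniq_xi c x : x = \sum_i c i *: b i -> forall i, xi i x = c i.
  move=> xE i; apply/eqP; rewrite -subr_eq0; apply/eqP.
  apply: (bfree (fun i => xi i x - c i)).
  by under eq_bigr do rewrite scalerBl; rewrite sumrB -xiE -xE subrr.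
exists b, xi; split=> // [i a x y | i j].
  apply: (uniq_xi (fun i => a * xi i x + xi i y)).
  under eq_bigr do rewrite scalerDl -scalerA.
  by rewrite big_split -scaler_sumr -!xiE.
apply: (uniq_xi (fun i => (i == j)%:R)).
rewrite (bigD1 j) //= eqxx scale1r big1 ?addr0 // => l /negPf->.
by rewrite scale0r.
Qed.

(** * The trace of left multiplication as an integral of the dual *)

Section RegularTrace.
Variables (k : fieldType) (K : algType k) (Delta : K -> seq (K * K)).
Variables (eps : K -> k) (S : K -> K).
Hypothesis hopfK : is_hopf Delta eps S.
Hypothesis SS : forall x, S (S x) = x.
Variables (n : nat) (b : 'I_n -> K) (xi : 'I_n -> K -> k).
Hypothesis xi_lin : forall i, lin_functional (xi i).
Hypothesis b_span : forall x, x = \sum_i xi i x *: b i.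
Hypothesis xi_b : forall i j, xi i (b j) = (i == j)%:R.

Let lS := antipode_lin hopfK.
Let leps := counit_lin hopfK.

Ltac lins := repeat (intros; first
  [ exact: xi_lin | apply: (lin_comul hopfK) | apply: lin_tsum_param | lin_step ]).

(** Apply [S] to y_1 S(y_2) = eps(y): it reverses the product and, being an involution, yields y_2
    S(y_1). *)
Lemma involutive_antipode_swap (W : lmodType k) (g : K -> W) y : lin g ->
  tsum (fun a c => g (c * S a)) (Delta y) = eps y *: g 1.
Proof.
move=> lg; rewrite -(antipode1 hopfK).
rewrite -(antipoder hopfK (g := fun z => g (S z))); last by lins.
by apply: eq_tsum => a c; rewrite (antipodeM hopfK) SS.
Qed.

(** The left side expands to x_1 y_2 S(y_1) (x) x_2 y_3, where y_2 S(y_1) collapses by the swapped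
    antipode identity. This is where S^2 = id enters the trace argument. *)
Lemma twisted_comul (W : lmodType k) (f : K -> K -> W) x y : bilin f ->
  tsum (fun p q => tsum (fun a c => f (a * S p) c) (Delta (x * q))) (Delta y)
  = tsum (fun a c => f a (c * y)) (Delta x).
Proof.
move=> bf.
transitivity (tsum (fun a c => tsum (fun p q => tsum (fun r s =>
    f (a * (r * S p)) (c * s)) (Delta q)) (Delta y)) (Delta x)).
  rewrite [RHS]tsum_exchange; apply: eq_tsum => p q.
  rewrite (comulM hopfK); last by lins.
  by do 2!apply: eq_tsum => ? ?; rewrite mulrA.
apply: eq_tsum => a c.
rewrite -(comul_coassoc hopfK (f := fun p r s => f (a * (r * S p)) (c * s)));
  last by lins.
rewrite -(counitl hopfK (g := fun z => f a (c * z))); last by lins.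
apply: eq_tsum => p s.
rewrite (involutive_antipode_swap (g := fun z => f (a * z) (c * s))) ?mulr1 //.
by lins.
Qed.

Definition regular_trace (x : K) : k := \sum_i xi i (x * b i).

Lemma regular_trace_lin : lin_functional regular_trace.
Proof.
by apply: (lin_big (W := k^o)) => i; have li := xi_lin i;
   apply: (functional_comp li); lins.
Qed.

Lemma regular_trace1 : regular_trace 1 = n%:R.
Proof.
rewrite /regular_trace; under eq_bigr do rewrite mul1r xi_b eqxx.
by rewrite sumr_const card_ord.
Qed.

Lemma comul_expand (W : lmodType k) (f : K -> K -> W) x : bilin f ->
  tsum f (Delta x)
  = \sum_i f (tsum (fun a c => xi i c *: a) (Delta x)) (b i).
Proof.
move=> bf; transitivity (tsum (fun a c => \sum_i xi i c *: f a (b i)) (Delta x)).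
  apply: eq_tsum => a c; rewrite {1}(b_span c).
  rewrite (lin_sum (lin_bilinr a bf (@lin_id _ _))); apply: eq_bigr => i _.
  by rewrite (linZ (lin_bilinr a bf (@lin_id _ _))).
rewrite /tsum exchange_big; apply: eq_bigr => i _.
rewrite (lin_sum (lin_bilinl (b i) bf (@lin_id _ _))); apply: eq_bigr => p _.
by rewrite (linZ (lin_bilinl (b i) bf (@lin_id _ _))).
Qed.

(** The matrix of [K] as a left comodule over itself: Delta(b_i) is the sum over j of C_ij (x)
    b_j. *)
Let C i j := tsum (fun a c => xi j c *: a) (Delta (b i)).

Lemma regular_comatrix : comatrix Delta eps C.
Proof.
split=> [W f i j bf | i j].
  rewrite (lin_tsum _ _ (lin_comul hopfK bf (@lin_id _ _))).
  transitivity (tsum (fun p c => tsum (fun a d => xi j c *: f a d) (Delta p))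
    (Delta (b i))).
    apply: eq_tsum => p c; rewrite (linZ (lin_comul hopfK bf (@lin_id _ _))).
    by rewrite (lin_tsum _ _ (lin_scale _ (@lin_id _ _))).
  rewrite (comul_coassoc hopfK (f := fun a d c => xi j c *: f a d)); last by lins.
  rewrite comul_expand; last by lins.
  apply: eq_bigr => s _; rewrite (lin_tsum _ _ (lin_bilinr _ bf (@lin_id _ _))).
  by apply: eq_tsum => a c; rewrite (linZ (lin_bilinr _ bf (@lin_id _ _))).
rewrite /C (lin_tsum (W := k^o) _ _ leps).
transitivity (tsum (fun a c => eps a *: (xi j c : k^o)) (Delta (b i))).
  by apply: (eq_tsum (W := k^o)) => a c; rewrite (linZ (W := k^o) leps) [LHS]mulrC.
by rewrite (counitl (W := k^o) hopfK _ (xi_lin j)) xi_b eq_sym.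
Qed.

(* Rewriting [x1 (x) x2 b_i] as [(x b_i2)_1 S(b_i1) (x) (x b_i2)_2] conjugates
   left multiplication by x by the matrix C of the coproduct. *)
Lemma regular_trace_integral x :
  tsum (fun a c => regular_trace c *: a) (Delta x) = regular_trace x *: 1.
Proof.
transitivity (\sum_i \sum_j \sum_l xi l (x * b j) *: (C l i * S (C i j))).
  rewrite /regular_trace.
  transitivity (\sum_i tsum (fun a c => xi i (c * b i) *: a) (Delta x)).
    rewrite /tsum [RHS]exchange_big; apply: eq_bigr => p _.
    by rewrite scaler_suml.
  apply: eq_bigr => i _.
  rewrite -(twisted_comul (f := fun a c => xi i c *: a)); last by lins.
  rewrite comul_expand; last by lins.
  apply: eq_bigr => j _; rewrite -/(C i j).
  have bf : bilin (fun a c => xi i c *: (a * S (C i j))) by lins.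
  rewrite {1}(b_span (x * b j)) (lin_sum (lin_comul hopfK bf (@lin_id _ _))).
  apply: eq_bigr => l _; rewrite (linZ (lin_comul hopfK bf (@lin_id _ _))).
  congr (_ *: _); rewrite comul_expand // (bigD1 i) //= xi_b eqxx scale1r.
  by rewrite big1 ?addr0 // => s /negPf si; rewrite xi_b eq_sym si scale0r.
rewrite exchange_big /regular_trace scaler_suml; apply: eq_bigr => j _ /=.
rewrite exchange_big (bigD1 j) //= -scaler_sumr.
rewrite (comatrix_antipoder hopfK _ _ regular_comatrix) eqxx.
rewrite big1 ?addr0 // => l /negPf lj; rewrite -scaler_sumr.
by rewrite (comatrix_antipoder hopfK _ _ regular_comatrix) lj scaler0.
Qed.
End RegularTrace.

(** * Projections onto subspaces given by predicates *)

Lemma row_subspace_matrix (k : fieldType) n (P : 'rV[k]_n -> Prop) :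
  P 0 -> (forall a u v, P u -> P v -> P (a *: u + v)) ->
  exists M : 'M[k]_n, forall v, P v <-> (v <= M)%MS.
Proof.
move=> P0 PL.
(* Either some matrix already cuts out [P], or [P] contains a row space of dimension at least [r]: a
   row of [P] outside the current row space raises the rank. At [n.+1] only the first case
   survives. *)
have step r : (exists M : 'M[k]_n, forall v, P v <-> (v <= M)%MS) \/
    exists M : 'M[k]_n, (forall v, (v <= M)%MS -> P v) /\ (r <= \rank M)%N.
  elim: r => [|r [|[M [MP rM]]]]; [| by left |].
    by right; exists 0; split=> // v; rewrite submx0 => /eqP->.
  have [[v [Pv vM]] | nov] := classic (exists v, P v /\ ~~ (v <= M)%MS); last first.
    left; exists M => v; split=> [Pv | /MP //].
    by apply/negPn/negP => vM; apply: nov; exists v.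
  right; exists (M + v)%MS; split.
    move=> u /sub_addsmxP[[c1 c2] /= ->]; rewrite addrC -[c2 *m v]addr0.
    rewrite [c2]mx11_scalar mul_scalar_mx addr0; apply: PL => //; apply: MP.
    exact: submxMl.
  apply: leq_ltn_trans rM _; apply: rank_ltmx.
  by rewrite ltmxE addsmxSl addsmx_sub submx_refl.
have [//|[M [_ ]]] := step n.+1.
by rewrite ltnNge rank_leq_row.
Qed.

(** [theta] is the transpose of a linear projection of the dual space onto [I]; working on [V] lets
    it act inside Sweedler sums. *)
Lemma functional_subspace_projection (k : fieldType) (V : lmodType k) n
    (b : 'I_n -> V) (xi : 'I_n -> V -> k) (I : (V -> k) -> Prop) :
  (forall i, lin_functional (xi i)) -> (forall x, x = \sum_i xi i x *: b i) ->
  (forall f, I f -> lin_functional f) -> I (fun _ => 0) ->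
  (forall f g, I f -> I g -> I (fun x => f x + g x)) ->
  (forall (a : k) f, I f -> I (fun x => a * f x)) ->
  exists theta : V -> V,
    [/\ lin theta, forall f, lin_functional f -> I (fun x => f (theta x)) &
        forall f, I f -> forall x, f (theta x) = f x].
Proof.
move=> xi_lin b_span Ilin I0 ID IZ.
have fE f x : lin_functional f -> f x = \sum_i f (b i) * xi i x.
  move=> lf; rewrite {1}(b_span x) (lin_sum (W := k^o) lf).
  by apply: eq_bigr => i _; rewrite (linZ (W := k^o) lf) [LHS]mulrC.
have [||M MP] := @row_subspace_matrix k n
  (fun v => I (fun x => \sum_i v 0 i * xi i x)).
- suff -> : (fun x => \sum_i (0 : 'rV[k]_n) 0 i * xi i x) = (fun _ => 0) by [].
  apply: functional_extensionality => x.
  by rewrite big1 // => i _; rewrite mxE mul0r.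
- move=> a u v Iu Iv.
  suff -> : (fun x => \sum_i (a *: u + v) 0 i * xi i x)
    = (fun x => a * (\sum_i u 0 i * xi i x) + \sum_i v 0 i * xi i x).
    exact: ID (IZ _ _ Iu) Iv.
  apply: functional_extensionality => x.
  rewrite mulr_sumr -big_split; apply: eq_bigr => i _.
  by rewrite !mxE mulrDl mulrA.
(* [Q] sends every row into the row space of [M] and fixes that space; [v f] lists coefficients of
   [f] with respect to the [xi i]. *)
pose Q := pinvmx M *m M; pose v f := \row_i f (b i) : 'rV[k]_n.
exists (fun x => \sum_j xi j x *: \sum_i Q i j *: b i).
have thetaE f x : lin_functional f ->
    f (\sum_j xi j x *: \sum_i Q i j *: b i) = \sum_j (v f *m Q) 0 j * xi j x.
  move=> lf; rewrite (lin_sum (W := k^o) lf); apply: eq_bigr => j _.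
  rewrite (linZ (W := k^o) lf) (lin_sum (W := k^o) lf) [LHS]mulrC; congr (_ * _).
  rewrite mxE; apply: eq_bigr => i _; rewrite (linZ (W := k^o) lf) [RHS]mulrC.
  by rewrite [v f 0 i]mxE.
split.
- by apply: lin_big => j; apply: lin_scale_functional.
- move=> f lf.
  suff -> : (fun x => f (\sum_j xi j x *: \sum_i Q i j *: b i))
    = (fun x => \sum_j (v f *m Q) 0 j * xi j x).
    by apply/MP; rewrite mulmxA submxMl.
  by apply: functional_extensionality => x; apply: thetaE.
- move=> f If x; have lf := Ilin f If; rewrite thetaE // [RHS]fE //.
  have vM : (v f <= M)%MS.
    apply/MP; suff <- : f = (fun x => \sum_i v f 0 i * xi i x) by [].
    apply: functional_extensionality => y; rewrite fE //.
    by apply: eq_bigr => i _; rewrite mxE.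
  by apply: eq_bigr => j _; rewrite mulmxA mulmxKpV // mxE.
Qed.

(** * Averaging against a normalized integral *)

Section Maschke.
Variables (k : fieldType) (K : algType k) (Delta : K -> seq (K * K)).
Variables (eps : K -> k) (S : K -> K).
Hypothesis hopfK : is_hopf Delta eps S.
Variable lam : K -> k.
Hypothesis lam_lin : lin_functional lam.
Hypothesis lam1 : lam 1 = 1.
Hypothesis lam_integral : forall x,
  tsum (fun a c => lam c *: a) (Delta x) = lam x *: 1.

Let lS := antipode_lin hopfK.
Let leps := counit_lin hopfK.

Ltac lins := repeat (intros; first
  [ apply: (lin_comul hopfK) | apply: lin_tsum_param | lin_step ]).

(** The averaging kernel: a left inverse of [Delta] that is colinear for the coaction on the first
    factor, as [twist_comul] and [comul_twist] show. *)
Definition twist u z := tsum (fun c d => lam (u * S c) *: d) (Delta z).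

Lemma twist_bilin : bilin twist.
Proof. by rewrite /twist; lins. Qed.

(** Integrality replaces lam(y) 1 by y_1 lam(y_2) for y = u S(z_1). Since [S] reverses the
    coproduct, this produces a factor S(z_2) z_3, which cancels. *)
Lemma comul_twist (W : lmodType k) (f : K -> K -> W) u z : bilin f ->
  tsum f (Delta (twist u z)) = tsum (fun a c => f a (twist c z)) (Delta u).
Proof.
move=> bf; rewrite (lin_tsum _ _ (lin_comul hopfK bf (@lin_id _ _))).
transitivity (tsum (fun c p => tsum (fun a d => tsum (fun q r =>
    lam d *: f (a * q) r) (Delta p)) (Delta (u * S c))) (Delta z)).
  apply: eq_tsum => c p; rewrite (linZ (lin_comul hopfK bf (@lin_id _ _))).
  rewrite (lin_tsum _ _ (lin_scale _ (@lin_id _ _))) tsum_exchange.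
  apply: eq_tsum => q r; have lg : lin (fun y => f (y * q) r) by lins.
  rewrite -[q in LHS]mul1r -(linZ lg) -lam_integral (lin_tsum _ _ lg).
  by apply: eq_tsum => a d; rewrite (linZ lg).
transitivity (tsum (fun a d => tsum (fun c p => tsum (fun s t => tsum (fun q r =>
    lam (d * S s) *: f (a * (S t * q)) r) (Delta p)) (Delta c)) (Delta z)) (Delta u)).
  rewrite [RHS]tsum_exchange; apply: eq_tsum => c p.
  rewrite (comulM hopfK); last by lins.
  apply: eq_tsum => a d; rewrite (comul_antipode hopfK); last by lins.
  by do 2!apply: eq_tsum => ? ?; rewrite mulrA.
apply: eq_tsum => a d.
rewrite (antipodel_middle hopfK (G := fun s y r => lam (d * S s) *: f (a * y) r));
  last by lins.
rewrite /twist (lin_tsum _ _ (lin_bilinr a bf (@lin_id _ _))).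
by apply: eq_tsum => s r; rewrite (linZ (lin_bilinr a bf (@lin_id _ _))) mulr1.
Qed.

(** lam(x_1 S(x_2)) x_3 collapses to lam(1) x, which is why [lam] is normalized. *)
Lemma twist_comul x : tsum twist (Delta x) = x.
Proof.
rewrite /twist -(comul_coassoc hopfK (f := fun a c d => lam (a * S c) *: d));
  last by lins.
rewrite -[RHS](counitl hopfK x (@lin_id _ _)); apply: eq_tsum => p d.
rewrite (antipoder hopfK (g := fun y => lam y *: d)); last by lins.
by rewrite lam1 scale1r.
Qed.

Definition average (theta : K -> K) x := tsum (fun a d => twist a (theta d)) (Delta x).

Lemma average_lin theta : lin theta -> lin (average theta).
Proof. by move=> lt; have bt := twist_bilin; rewrite /average; lins. Qed.

Lemma comul_average (W : lmodType k) (f : K -> K -> W) theta x :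
  lin theta -> bilin f ->
  tsum f (Delta (average theta x)) = tsum (fun a c => f a (average theta c)) (Delta x).
Proof.
move=> lt bf; have bt := twist_bilin.
rewrite (lin_tsum _ _ (lin_comul hopfK bf (@lin_id _ _))).
transitivity (tsum (fun p d => tsum (fun a c => f a (twist c (theta d))) (Delta p))
  (Delta x)).
  by apply: eq_tsum => p d; rewrite comul_twist.
rewrite (comul_coassoc hopfK (f := fun a c d => f a (twist c (theta d))));
  last by lins.
by apply: eq_tsum => a p; rewrite (lin_tsum _ _ (lin_bilinr a bf (@lin_id _ _))).
Qed.

(** Composition with [average theta] is a projection of the dual onto [I] that commutes with left
    convolution, so its kernel is a complementary left ideal. *)
Lemma dual_semisimple_of_integral n : fin_dim_with K n -> dual_semisimple Delta.
Proof.
move=> /fin_dim_coords[b [xi [xi_lin b_span _]]] I [Ilin I0 ID IZ Iconv].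
have [theta [lt thetaI thetaE]] :=
  functional_subspace_projection xi_lin b_span Ilin I0 ID IZ.
have bt := twist_bilin; have lA := average_lin lt.
have AE f x : I f -> f (average theta x) = f x.
  move=> If; have lf := Ilin f If.
  have Itw u : I (fun z => f (twist u z)).
    suff -> : (fun z => f (twist u z)) = conv Delta (fun c => lam (u * S c)) f.
      by apply: Iconv => //; lins.
    apply: functional_extensionality => z; rewrite (lin_tsum (W := k^o) _ _ lf).
    by apply: eq_bigr => p _; rewrite (linZ (W := k^o) lf).
  rewrite -[in RHS](twist_comul x) !(lin_tsum (W := k^o) _ _ lf).
  by apply: (eq_tsum (W := k^o)) => a d; apply: (thetaE _ (Itw a)).
have Isum (F : 'I_n -> K -> k) : (forall i, I (F i)) -> I (fun x => \sum_i F i x).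
  move=> IF; elim: (index_enum _) => [|i r Ir].
    suff -> : (fun x => \sum_(i <- [::]) F i x) = (fun _ => 0) by [].
    by apply: functional_extensionality => x; rewrite big_nil.
  suff -> : (fun x => \sum_(j <- i :: r) F j x)
      = (fun x => F i x + \sum_(j <- r) F j x) by apply: ID.
  by apply: functional_extensionality => x; rewrite big_cons.
have AI f : lin_functional f -> I (fun x => f (average theta x)).
  move=> lf.
  (* Expanding the first leg of [Delta x] in the basis writes the averaged functional as a finite
     sum of convolutions with elements of [I]. *)
  suff -> : (fun x => f (average theta x))
      = fun x => \sum_i conv Delta (xi i) (fun z => f (twist (b i) (theta z))) x.
    apply: Isum => i; apply: Iconv => //.
    apply: (thetaI (fun z => f (twist (b i) z))); lins.
  apply: functional_extensionality => x; rewrite (lin_tsum (W := k^o) _ _ lf).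
  rewrite /tsum exchange_big; apply: eq_bigr => p _ /=.
  have lg : lin_functional (fun u => f (twist u (theta p.2))) by lins.
  rewrite {1}(b_span p.1) (lin_sum (W := k^o) lg); apply: eq_bigr => i _.
  by rewrite (linZ (W := k^o) lg).
exists (fun f => lin_functional f /\ forall x, f (average theta x) = 0); split.
- split.
  + by move=> f [].
  + by split=> // a x y; rewrite mulr0 addr0.
  + move=> f g [lf f0] [lg g0]; split=> [a x y | x]; last by rewrite f0 g0 addr0.
    by rewrite lf lg mulrDr addrACA.
  + move=> a f [lf f0]; split=> [c x y | x]; last by rewrite f0 mulr0.
    by rewrite lf mulrDr !mulrA [a * c]mulrC.
  + move=> h f lh [lf f0].
    have bhf : bilin (fun c d => h c *: (f d : k^o)).
      apply: bilinP => y; first exact: lin_scale_functional.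
      exact: lin_scale.
    split; first exact: (lin_comul hopfK bhf (@lin_id _ _)).
    move=> x; transitivity (tsum (fun c d => h c *: (f d : k^o))
      (Delta (average theta x))) => //.
    rewrite comul_average // /tsum big1 // => p _; rewrite f0.
    exact: scaler0.
- by move=> f If [_ f0] x; rewrite -(AE f x If).
- move=> f lf; exists (fun x => f (average theta x)).
  exists (fun x => f x - f (average theta x)); split; first exact: AI.
    split=> [a x y | x]; last first.
      by have /= -> := AE _ x (AI f lf); rewrite subrr.
    by rewrite lA !lf mulrBr opprD addrACA.
  by move=> x; rewrite addrC subrK.
Qed.
End Maschke.

Theorem theorem3p3 (k : fieldType)
    (E : falgType k) (Eg : nat -> {vspace E}) (B : E -> E -> k)
    (K : algType k) (Delta : K -> seq (K * K)) (eps : K -> k) (S : K -> K)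
    (rho : E -> seq (K * E)) :
  (* E connected graded Frobenius *)
  is_conn_graded Eg ->
  is_graded_frobenius_form Eg B ->
  (* Nakayama automorphism restricts to a scalar on E_1 *)
  (exists mu : E -> E, is_nakayama B mu /\
     exists lam : k, forall a, a \in Eg 1%N -> mu a = lam *: a) ->
  (* K Hopf, E left K-comodule algebra *)
  is_hopf Delta eps S ->
  is_comod_alg Delta eps rho ->
  (* grading-preserving coaction *)
  (forall i x, x \in Eg i -> exists s, teq (rho x) s /\
                 forall p, p \in s -> p.2 \in Eg i) ->
  (* inner-faithful on E_1 *)
  (forall K' : K -> Prop, is_hopf_subalg Delta S K' -> (exists x, ~ K' x) ->
     exists e, e \in Eg 1%N /\
       ~ (exists s, teq (rho e) s /\ forall p, p \in s -> K' p.1 /\ p.2 \in Eg 1%N)) ->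
  (* trivial homological codeterminant: rho(e) = 1 (x) e for e spanning the top degree *)
  (forall d, Eg d != 0%VS -> (forall i, (d < i)%N -> Eg i = 0%VS) ->
     forall e, e \in Eg d -> e != 0 -> teq (rho e) [:: (1, e)]) ->
  (forall x, S (S x) = x) /\
  (forall n, fin_dim_with K n -> (forall p, p \in [pchar k] -> ~~ (p %| n)%N) ->
     dual_semisimple Delta).
Proof.
move=> grE frobB nak hopfK comodE rho_graded inner codet.
have SS : forall x, S (S x) = x.
  exact: (antipode_involutive grE frobB nak hopfK comodE rho_graded inner codet).
split=> // n dimK charn.
have [b [xi [xi_lin b_span xi_b]]] := fin_dim_coords dimK.
(* In characteristic zero the divisibility hypothesis does not exclude n = 0; the fact that 1 is
   nonzero in [K] does. *)
have n_gt0 : (0 < n)%N.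
  case: n b xi b_span {dimK charn xi_lin xi_b} => // b xi b_span.
  by have := oner_neq0 K; rewrite (b_span 1) big_ord0 eqxx.
have n0 : n%:R != 0 :> k.
  apply/negP => n0; have [p pk] := natf0_pchar n_gt0 n0.
  by have := charn p pk; rewrite (dvdn_pcharf pk) n0.
have ltr := regular_trace_lin b xi_lin.
(* The trace takes the value [n] at 1, so dividing by [n] normalizes the integral. *)
pose lam x := n%:R^-1 * regular_trace b xi x.
apply: (dual_semisimple_of_integral hopfK (lam := lam) _ _ _ dimK).
- by move=> a x y; rewrite /lam ltr mulrDr mulrCA.
- by rewrite /lam (regular_trace1 xi_b) mulVf.
- move=> x; rewrite /lam -scalerA.
  rewrite -(regular_trace_integral hopfK SS xi_lin b_span xi_b).
  by rewrite /tsum scaler_sumr; apply: eq_bigr => p _; rewrite scalerA.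
Qed.
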